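(* Let $G$ be a group and let $S\subset G$ be a finite subset with $1\in S$. Let $M$ be a $u$-kernel of $S$ which is a subgroup of $G$, and let $N$ be a subgroup of $G$ which is a $v$-cell of $S$, where $u,v\le |S|-1$. \begin{itemize} \item[(i)] If either $N$ is a $v$-kernel of $S$ or $u=v$, then $M\subset N$ or $N\subset M$. \item[(ii)] If $N$ is a $v$-kernel of $S$ and $v\le u$, then $M\subset N$. \end{itemize}
   Context: For subsets $X,Y$ of a group $G$, $XY=\{xy: x\in X, y\in Y\}$ and $zY=\{z\}Y$. Let $S$ be a finite subset of $G$ with $1\in S$. A cell of $S$ is a finite subset $X\subset G$ such that for every $z\in G\setminus X$ one has $zS\not\subset XS$. For an integer $u$, a $u$-cell of $S$ is a cell $X$ of $S$ with $|XS|-|X|=u$. A $u$-kernel of $S$ is a $u$-cell of $S$ of minimal cardinality among all $u$-cells of $S$. *)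

(* Defs.v *)
From mathcomp Require Import all_boot all_order all_algebra all_fingroup finmap.

Set Implicit Arguments.
Unset Strict Implicit.
Unset Printing Implicit Defensive.

Local Open Scope fset_scope.
Local Open Scope group_scope.

Definition setprod (G : groupType) (X Y : {fset G}) : {fset G} :=
  [fset x * y | x in X, y in Y].

(* The empty set is not excluded: it is a 0-cell as soon as S is nonempty. *)
Definition cell (G : groupType) (S X : {fset G}) : Prop :=
  forall z : G, z \notin X -> ~~ (setprod [fset z] S `<=` setprod X S).

Definition ucell (G : groupType) (S : {fset G}) (u : int) (X : {fset G}) : Prop :=
  cell S X /\ (#|` setprod X S|%:Z - #|` X|%:Z)%R = u.

Definition ukernel (G : groupType) (S : {fset G}) (u : int) (X : {fset G}) : Prop :=
  ucell S u X /\ forall Y : {fset G}, ucell S u Y -> #|` X| <= #|` Y|.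

Definition is_subgroup (G : groupType) (X : {fset G}) : Prop :=
  group_closed (mem X).

(* Main.v *)
Require Import Defs.
From mathcomp Require Import all_boot all_algebra finmap boolp zify.

(* Write [m], [n], [h] for the orders of [M], [N], [H := M `&` N], and suppose
   that neither of [M], [N] contains the other.  The boundary [w := |H S| - h]
   is at least [u] and [v]: like them it is a multiple of [h], and
   [|H S| >= |S|] exceeds both.  As [H S] lies in [M S] and in [N S], the
   symmetric difference of [M S] and [N S] has at most
   [u + v - 2 w + m + n - 2 h] elements.  It also has at least [m + n - 2 h], so
   [2 w <= u + v]; hence [w = u], and [H] is a [u]-cell smaller than the
   [u]-kernel [M].

   The lower bound is an edge-connectivity argument in the bipartite graph whose
   vertices are the right cosets of [M] and of [N], two being joined when they
   meet; its edges are the right cosets of [H], on which [G] acts transitively.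
   A set of vertices is a pair [(A, B)] with [M A = A] and [N B = B], and the
   symmetric difference of [A] and [B] is the union of the edges that leave it;
   its cardinal is a submodular function of the pair.  Among the pairs such that
   both [(A, B)] and its complement in the connected component of [1] span an
   edge, consider one that minimizes first this cardinal and then [|A| + |B|].
   If the cardinal is less than [m + n], then distinct translates of the pair
   share no edge, so [A `&` B] is a translate of a subgroup, and counting cosets
   gives [m + n - 2 h]. *)

Set Implicit Arguments.
Unset Strict Implicit.
Unset Printing Implicit Defensive.

Lemma ex_minimizer (T : Type) (P : T -> Prop) (mu : T -> nat) :
  (exists x, P x) -> exists2 x, P x & forall y, P y -> mu x <= mu y.
Proof.
move=> [x0 Px0].
have ex_value : exists n, `[< exists2 x, P x & mu x = n >].
  by exists (mu x0); apply/asboolP; exists x0.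
case: (ex_minnP ex_value) => _ /asboolP[x Px <-] min_x.
by exists x => // y Py; apply: min_x; apply/asboolP; exists y.
Qed.

(* In the application [m], [n], [h], [f] are the orders of [M], [N], [M `&` N]
   and of a third subgroup [F], [a], [b] those of [M `&` F], [N `&` F], and
   [p], [q] the cardinals of [M F], [N F].  The two waypoints are
   [0 <= (n - 2h)(a - h)], with the roles of [M] and [N] exchanged in the other
   case, and [0 <= (f h - a b)(m b + n a - 2 a b)]. *)
Lemma coset_count_bound (m n f h a b p q : nat) :
    0 < h <= a -> h <= b -> h.*2 <= m -> h.*2 <= n -> a <= m -> b <= n ->
    (a.*2 <= m) || (b.*2 <= n) ->
    p * a = m * f -> q * b = n * f -> a * b <= f * h ->
  m + n + f.*2 <= p + q + h.*2.
Proof.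
move=> /andP[h_gt0 leha] lehb lehm lehn leam lebn half pa qb leab.
have ab_gt0 : 0 < a * b by rewrite muln_gt0; lia.
have index_bound : h * (m + n) + (a * b).*2 <= m * b + n * a + (h * h).*2.
  by case/orP: half => half; nia.
have excess_bound : m * b + n * a + (h * f).*2 <= h * (p + q) + (a * b).*2.
  have total : h * (p + q) * (a * b) = h * f * (m * b + n * a).
    have -> : h * (p + q) * (a * b) = h * b * (p * a) + h * a * (q * b) by lia.
    by rewrite pa qb; lia.
  rewrite -(leq_pmul2r ab_gt0) [in leqRHS]mulnDl total.
  have : (a * b).*2 <= m * b + n * a by nia.
  move: (m * b + n * a) (a * b) leab => s t leab; nia.
by rewrite -(leq_pmul2l h_gt0); lia.
Qed.

Local Open Scope fset_scope.
Local Open Scope group_scope.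

Local Notation "A ** B" := (setprod A B) (at level 40, left associativity).

Section ClosedSets.

Variables (G : groupType) (K : {pred G}).
Hypothesis gK : group_closed K.

Lemma group_closedMl (x y : G) : x \in K -> (x * y \in K) = (y \in K).
Proof.
move=> xK; apply/idP/idP => [xyK|]; last exact: (group_closedM gK).
by rewrite -(mulKg x y); apply: (group_closedM gK (group_closedV gK xK) xyK).
Qed.

Lemma group_closedMr (x y : G) : x \in K -> (y * x \in K) = (y \in K).
Proof.
move=> xK; apply/idP/idP => [yxK|yK]; last exact: (group_closedM gK).
by rewrite -(mulgK x y); apply: gK.2.
Qed.

End ClosedSets.

Section SetProducts.

Variable G : groupType.
Implicit Types (A B H M S T X : {fset G}) (g x y z : G).

Lemma setprodP {A B z} :
  reflect (exists2 a, a \in A & exists2 b, b \in B & z = a * b) (z \in A ** B).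
Proof. exact: imfset2P. Qed.

Lemma mem_setprod A B x y : x \in A -> y \in B -> x * y \in A ** B.
Proof. by move=> xA yB; apply/setprodP; exists x => //; exists y. Qed.

Lemma setprodSl A B S : A `<=` B -> A ** S `<=` B ** S.
Proof.
move=> /fsubsetP sAB; apply/fsubsetP=> _ /setprodP[a aA [s sS ->]].
by apply: mem_setprod => //; exact: sAB.
Qed.

Lemma mem_rcoset A g z : (z \in A ** [fset g]) = (z * g^-1 \in A).
Proof.
apply/setprodP/idP => [[a aA [_ /fset1P-> ->]]|zA]; first by rewrite mulgK.
by exists (z * g^-1) => //; exists g; rewrite ?fset11 // mulgVK.
Qed.

Lemma mem1_rcosetV A x : (1 \in A ** [fset x^-1]) = (x \in A).
Proof. by rewrite mem_rcoset invgK mul1g. Qed.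

Lemma card_rcoset A g : #|` A ** [fset g]| = #|` A|.
Proof.
have -> : A ** [fset g] = [fset x * g | x in A].
  apply/fsetP=> z; rewrite mem_rcoset; apply/idP/imfsetP => [zA|[x xA ->]].
    by exists (z * g^-1); rewrite // mulgVK.
  by rewrite mulgK.
by apply: card_imfset; exact: mulIg.
Qed.

Lemma subgroupI M H : is_subgroup M -> is_subgroup H -> is_subgroup (M `&` H).
Proof.
move=> [M1 MF] [H1 HF]; split=> [|x y]; rewrite !inE; first by rewrite M1 H1.
by move=> /andP[xM xH] /andP[yM yH]; rewrite MF ?HF.
Qed.

Lemma subgroup_card_gt0 M : is_subgroup M -> 0 < #|` M|.
Proof. by move=> [M1 _]; rewrite cardfs_gt0; apply/fset0Pn; exists 1. Qed.

Lemma sub_setprod M S : is_subgroup M -> S `<=` M ** S.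
Proof.
by move=> [M1 _]; apply/fsubsetP=> x xS; rewrite -[x]mul1g; apply: mem_setprod.
Qed.

Definition left_stable M A : Prop := {in M & A, forall x y, x * y \in A}.

Lemma left_stable_setprod M S : is_subgroup M -> left_stable M (M ** S).
Proof.
move=> gM x _ xM /setprodP[a aM [s sS ->]]; rewrite mulgA.
by apply: mem_setprod => //; exact: (group_closedM gM xM aM).
Qed.

Lemma left_stable_subgroup H M :
  is_subgroup M -> H `<=` M -> left_stable H M.
Proof. by move=> gM /fsubsetP sHM x y /sHM; exact: (group_closedM gM). Qed.

Lemma setprod_sub_stable M S A : left_stable M A -> S `<=` A -> M ** S `<=` A.
Proof.
move=> stA /fsubsetP sSA; apply/fsubsetP=> _ /setprodP[a aM [s sS ->]].
by apply: stA => //; exact: sSA.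
Qed.

Lemma left_stableMl M A x y : is_subgroup M -> left_stable M A -> x \in M ->
  (x * y \in A) = (y \in A).
Proof.
move=> gM stA xM; apply/idP/idP => [xyA|]; last exact: stA.
by rewrite -(mulKg x y); apply: stA => //; exact: (group_closedV gM).
Qed.

Lemma left_stableS H M A : H `<=` M -> left_stable M A -> left_stable H A.
Proof. by move=> /fsubsetP sHM stA x y /sHM; apply: stA. Qed.

Lemma left_stableI M A B :
  left_stable M A -> left_stable M B -> left_stable M (A `&` B).
Proof.
move=> stA stB x y xM; rewrite !inE => /andP[yA yB].
by rewrite stA ?stB.
Qed.

Lemma left_stableU M A B :
  left_stable M A -> left_stable M B -> left_stable M (A `|` B).
Proof.
move=> stA stB x y xM; rewrite !inE => /orP[yA|yB].
  by rewrite stA.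
by rewrite stB ?orbT.
Qed.

Lemma left_stableD M A B : is_subgroup M ->
  left_stable M A -> left_stable M B -> left_stable M (A `\` B).
Proof.
move=> gM stA stB x y xM; rewrite !inE => /andP[yB yA].
by rewrite (left_stableMl y gM stB xM) yB stA.
Qed.

Lemma left_stable_rcoset M A g :
  left_stable M A -> left_stable M (A ** [fset g]).
Proof.
by move=> stA x y xM; rewrite !mem_rcoset -mulgA => yA; exact: stA.
Qed.

Lemma left_stable_card M A x : left_stable M A -> x \in A -> #|` M| <= #|` A|.
Proof.
move=> stA xA; rewrite -(card_rcoset M x); apply: fsubset_leq_card.
by apply: setprod_sub_stable; rewrite // fsub1set.
Qed.

Lemma left_stable_cardU_le M A B x :
    left_stable M A -> left_stable M B -> x \in A `&` B ->
  (#|` A `|` B| + #|` M| <= #|` A| + #|` B|)%N.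
Proof.
move=> stA stB xAB; rewrite -(cardfsUI A B) leq_add2l.
by apply: left_stable_card xAB; exact: left_stableI.
Qed.

Lemma left_stable_card_leqD A B H x : is_subgroup H -> left_stable H B ->
    {in H, forall h, h * x \in A `|` B} -> x \notin B ->
  #|` H| <= #|` A `\` B|.
Proof.
move=> gH stB sub xB; rewrite -(card_rcoset H x); apply: fsubset_leq_card.
apply/fsubsetP=> _ /setprodP[h hH [_ /fset1P-> ->]].
have := sub h hH; rewrite in_fsetU in_fsetD (left_stableMl x gH stB hH).
by rewrite (negPf xB) orbF => ->.
Qed.

Definition right_transversal H X T : Prop :=
  H ** T = X /\ {in T &, forall x y, x * y^-1 \in H -> x = y}.

Lemma card_right_transversal H X T : is_subgroup H ->
  right_transversal H X T -> #|` X| = (#|` H| * #|` T|)%N.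
Proof.
move=> gH [<- uniqT].
suff /perm_size-> : perm_eq (H ** T) [seq x * y | x <- H, y <- T].
  by rewrite size_allpairs.
apply: enum_imfset2.
move=> [x y] [z t] /andP[/= xH yT] /andP[/= zH tT] e.
have eyt : y = t.
  apply: uniqT => //; rewrite -(group_closedMl gH _ xH) mulgA e mulgK.
  exact: zH.
by move: e; rewrite eyt => /mulIg->.
Qed.

Lemma ex_right_transversal H X : is_subgroup H -> left_stable H X ->
  exists T, right_transversal H X T.
Proof.
move=> gH stX; pose rep x := choose (mem (H ** [fset x])) x.
have mem_self x : x \in H ** [fset x] by rewrite mem_rcoset mulgV; case: gH.
have rep_rcoset x : rep x * x^-1 \in H.
  rewrite -mem_rcoset; apply: (chooseP (P := mem (H ** [fset x]))).
  exact: mem_self.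
have rep_eq x y : x * y^-1 \in H -> rep x = rep y.
  move=> xyH; have e : H ** [fset x] =i H ** [fset y].
    move=> z; rewrite !mem_rcoset -(group_closedMr gH (z * x^-1) xyH).
    by rewrite mulgA mulgVK.
  rewrite /rep (eq_choose e).
  by apply: choose_id; [rewrite /= -e |]; exact: mem_self.
exists [fset rep x | x in X]; split.
  apply/fsetP=> z; apply/setprodP/idP => [[h hH [_ /imfsetP[x xX ->] ->]]|zX].
    by rewrite -(mulgVK x (rep x)) mulgA stX // (group_closedMl gH).
  exists (z * (rep z)^-1).
    by rewrite -[z * _]invgK; apply: (group_closedV gH); rewrite invgM invgK.
  by exists (rep z); rewrite ?mulgVK // in_imfset.
move=> _ _ /imfsetP[x xX ->] /imfsetP[y yX ->] xyH; apply: rep_eq.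
rewrite -(group_closedMl gH _ (rep_rcoset x)) mulgA mulgVK.
by rewrite -(mulgVK (rep y) (rep x)) -mulgA (group_closedMl gH _ xyH).
Qed.

Lemma dvdn_card_left_stable H X : is_subgroup H -> left_stable H X ->
  #|` H| %| #|` X|.
Proof.
move=> gH /(ex_right_transversal gH)[T /(card_right_transversal gH)->].
exact: dvdn_mulr.
Qed.

Lemma card_setprodI A B : is_subgroup A -> is_subgroup B ->
  (#|` A ** B| * #|` A `&` B| = #|` A| * #|` B|)%N.
Proof.
move=> gA gB; have gI := subgroupI gA gB.
have stB := left_stable_subgroup gB (fsubsetIr A B).
have [T trT] := ex_right_transversal gI stB; have [eB uniqT] := trT.
have sTB : T `<=` B by rewrite -eB sub_setprod.
have trA : right_transversal A (A ** B) T.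
  split; last first.
    move=> x y xT yT xyA; apply: uniqT => //; rewrite inE xyA /=.
    by apply: gB.2; exact: (fsubsetP sTB).
  apply/eqP; rewrite eqEfsubset; apply/andP; split; apply: setprod_sub_stable.
  - exact: left_stable_setprod.
  - exact: (fsubset_trans sTB (sub_setprod B gA)).
  - exact: left_stable_setprod.
  - by rewrite -{1}eB setprodSl // fsubsetIl.
rewrite (card_right_transversal gI trT) (card_right_transversal gA trA).
by rewrite -mulnA; congr (_ * _)%N; exact: mulnC.
Qed.

Lemma proper_subgroup_card M H : is_subgroup M -> is_subgroup H ->
  ~~ (M `<=` H) -> #|` M `&` H|.*2 <= #|` M|.
Proof.
move=> gM gH nMH; have gI := subgroupI gM gH.
have stM := left_stable_subgroup gM (fsubsetIl M H).
have /dvdnP[k ek] := dvdn_card_left_stable gI stM.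
have : #|` M `&` H| < #|` M|.
  by rewrite fproper_ltn_card // fproperE fsubsetIl fsubsetI fsubset_refl.
by rewrite ek; case: k {ek} => [|[|k]] //=; lia.
Qed.

Lemma card_setprod_subgroup_ge M N F :
    is_subgroup M -> is_subgroup N -> is_subgroup F ->
    M `&` N `<=` F -> ~~ (M `<=` N) -> ~~ (N `<=` M) ->
    ~~ ((M `<=` F) && (N `<=` F)) ->
  (#|` M| + #|` N| + #|` F|.*2 <=
   #|` M ** F| + #|` N ** F| + #|` M `&` N|.*2)%N.
Proof.
move=> gM gN gF sMNF nMN nNM nMNF.
have gMF := subgroupI gM gF; have gNF := subgroupI gN gF.
have eI : (M `&` F) `&` (N `&` F) = M `&` N.
  by rewrite -fsetIIl; exact/fsetIidPl.
have prodM := card_setprodI gM gF; have prodN := card_setprodI gN gF.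
have prod_le : (#|` M `&` F| * #|` N `&` F| <= #|` F| * #|` M `&` N|)%N.
  rewrite -(card_setprodI gMF gNF) eI leq_mul2r fsubset_leq_card ?orbT //.
  apply: setprod_sub_stable; last exact: fsubsetIr.
  by apply: left_stable_subgroup; rewrite ?fsubsetIr.
have half : (#|` M `&` F|.*2 <= #|` M|) || (#|` N `&` F|.*2 <= #|` N|).
  move: nMNF; rewrite negb_and => /orP[] /proper_subgroup_card-> //.
  by rewrite orbT.
have halfM := proper_subgroup_card gM gN nMN.
have halfN := proper_subgroup_card gN gM nNM; rewrite fsetIC in halfN.
apply: (coset_count_bound _ _ halfM halfN _ _ half prodM prodN prod_le).
- rewrite subgroup_card_gt0; last exact: subgroupI.
  by rewrite fsubset_leq_card // fsubsetI fsubsetIl.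
- by rewrite fsubset_leq_card // fsubsetI fsubsetIr.
- by rewrite fsubset_leq_card // fsubsetIl.
- by rewrite fsubset_leq_card // fsubsetIl.
Qed.

End SetProducts.

Section SymmetricDifference.

Variable G : groupType.
Implicit Types (A B C D U : {fset G}).

Definition card_symdiff A B : nat := #|` A `\` B| + #|` B `\` A|.

Lemma card_symdiffE A B :
  (card_symdiff A B + #|` A `&` B|.*2 = #|` A| + #|` B|)%N.
Proof.
have := cardfsID B A; have := cardfsID A B.
by rewrite fsetIC /card_symdiff; lia.
Qed.

Lemma card_symdiff_submodular A B C D :
  (card_symdiff (A `&` C) (B `&` D) + card_symdiff (A `|` C) (B `|` D) <=
   card_symdiff A B + card_symdiff C D)%N.
Proof.
have : #|` A `&` B `|` C `&` D| <= #|` (A `|` C) `&` (B `|` D)|.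
  by rewrite fsubset_leq_card // fsubUset !fsetISS ?fsubsetUl ?fsubsetUr.
have := cardfsUI (A `&` B) (C `&` D); rewrite fsetIACA.
have := cardfsUI A C; have := cardfsUI B D.
have := card_symdiffE A B; have := card_symdiffE C D.
have := card_symdiffE (A `&` C) (B `&` D).
have := card_symdiffE (A `|` C) (B `|` D); lia.
Qed.

Lemma card_symdiff_rcoset A B g :
  card_symdiff (A ** [fset g]) (B ** [fset g]) = card_symdiff A B.
Proof.
have rcosetD C D : C ** [fset g] `\` (D ** [fset g]) = (C `\` D) ** [fset g].
  by apply/fsetP=> x; rewrite !(inE, mem_rcoset).
by rewrite /card_symdiff !rcosetD !card_rcoset.
Qed.

Lemma card_symdiff_compl U A B : A `<=` U -> B `<=` U ->
  card_symdiff (U `\` A) (U `\` B) = card_symdiff A B.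
Proof.
have complD C D : D `<=` U -> (U `\` C) `\` (U `\` D) = D `\` C.
  move=> /fsubsetP sDU; apply/fsetP=> x; rewrite !inE; have := sDU x.
  by case: (x \in C) (x \in D) (x \in U) => -[] [] // /(_ isT).
by move=> sAU sBU; rewrite /card_symdiff !complD // addnC.
Qed.

Lemma card_symdiff_filter (P : {pred G}) A B :
  card_symdiff [fset x in A | P x] [fset x in B | P x] <= card_symdiff A B.
Proof.
have sub C D : [fset x in C | P x] `\` [fset x in D | P x] `<=` C `\` D.
  by apply/fsubsetP=> x; rewrite !inE; case: (P x); rewrite ?andbT ?andbF.
by apply: leq_add; apply: fsubset_leq_card.
Qed.

Lemma card_symdiffU A B :
  (card_symdiff A B + (#|` A| + #|` B|) = #|` A `|` B|.*2)%N.
Proof. by have := card_symdiffE A B; have := cardfsUI A B; lia. Qed.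

End SymmetricDifference.

Section Fragments.

Variables (G : groupType) (M N : {fset G}) (K : {pred G}).
Hypotheses (gM : is_subgroup M) (gN : is_subgroup N) (gK : group_closed K).
Hypotheses (sMK : {subset M <= K}) (sNK : {subset N <= K}).
Implicit Types (A B C D U : {fset G}).

(* Both [(A, B)] and its complement in [K] span an edge of the coset graph. *)
Definition fragment A B : Prop :=
  [/\ left_stable M A, left_stable N B, {subset A `|` B <= K}, A `&` B != fset0
    & exists2 k, k \in K & k \notin A `|` B].

Definition atom A B : Prop :=
  [/\ fragment A B,
      forall C D, fragment C D -> card_symdiff A B <= card_symdiff C D
    & forall C D, fragment C D -> card_symdiff C D = card_symdiff A B ->
        (#|` A| + #|` B| <= #|` C| + #|` D|)%N].

Lemma ex_atom A B : fragment A B -> exists C D, atom C D.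
Proof.
move=> frAB; pose is_fragment p := fragment p.1 p.2.
pose symdiff_of (p : {fset G} * {fset G}) := card_symdiff p.1 p.2.
have [|p frp min_p] := @ex_minimizer _ is_fragment symdiff_of.
  by exists (A, B).
pose same_symdiff q := is_fragment q /\ symdiff_of q = symdiff_of p.
have [|[C D] [frCD eCD] min_CD] :=
    @ex_minimizer _ same_symdiff (fun q => #|` q.1| + #|` q.2|)%N.
  by exists p.
exists C, D; split=> // [A' B' fr|A' B' fr e].
  by have := min_p (A', B') fr; rewrite -eCD.
by apply: (min_CD (A', B')); split; rewrite // -eCD.
Qed.

Lemma fragment_rcoset A B g : g \in K -> fragment A B ->
  fragment (A ** [fset g]) (B ** [fset g]).
Proof.
move=> Kg [stA stB sAB /fset0Pn[x xAB] [k kK kAB]].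
have KgV := group_closedV gK Kg; split.
- exact: left_stable_rcoset.
- exact: left_stable_rcoset.
- move=> y yAB; rewrite -(group_closedMr gK y KgV); apply: sAB.
  by rewrite !(inE, mem_rcoset) in yAB *.
- by apply/fset0Pn; exists (x * g); rewrite !(inE, mem_rcoset, mulgK) in xAB *.
- exists (k * g); first exact: (group_closedM gK).
  by rewrite !(inE, mem_rcoset, mulgK) in kAB *.
Qed.

Lemma fragment_meetV A B x : fragment A B -> x \in A `&` B -> x^-1 \in K.
Proof.
move=> [_ _ sAB _ _] /fsetIP[xA _]; apply: (group_closedV gK); apply: sAB.
by rewrite inE xA.
Qed.

Lemma atom_rcoset A B g : g \in K -> atom A B ->
  atom (A ** [fset g]) (B ** [fset g]).
Proof.
move=> Kg [frAB min_symdiff min_card].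
by split; rewrite ?card_symdiff_rcoset ?card_rcoset //; exact: fragment_rcoset.
Qed.

Lemma ex_atom_mem1 A B : fragment A B -> exists C D, atom C D /\ 1 \in C `&` D.
Proof.
move=> /ex_atom[C [D atCD]]; have [frCD _ _] := atCD.
have [_ _ _ /fset0Pn[x xCD] _] := frCD.
exists (C ** [fset x^-1]), (D ** [fset x^-1]); split.
  by apply: atom_rcoset => //; exact: fragment_meetV xCD.
by rewrite in_fsetI !mem1_rcosetV -in_fsetI.
Qed.

Lemma fragmentI A B C D : fragment A B -> fragment C D ->
  (A `&` B) `&` (C `&` D) != fset0 -> fragment (A `&` C) (B `&` D).
Proof.
move=> [stA stB sAB _ [k kK kAB]] [stC stD _ _ _] meet; split=> //.
- exact: left_stableI.
- exact: left_stableI.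
- move=> x xU; apply: sAB; move: xU.
  by rewrite !inE => /orP[] /andP[->]; rewrite ?orbT.
- by rewrite fsetIACA.
- exists k => //; apply: contra kAB.
  by rewrite !inE => /orP[] /andP[->]; rewrite ?orbT.
Qed.

Lemma fragmentU A B C D : fragment A B -> fragment C D ->
  (exists2 k, k \in K & k \notin A `|` C `|` (B `|` D)) ->
  fragment (A `|` C) (B `|` D).
Proof.
move=> [stA stB sAB meet _] [stC stD sCD _ _] out; split=> //.
- exact: left_stableU.
- exact: left_stableU.
- move=> x; rewrite fsetUACA => /fsetUP[]; [exact: sAB | exact: sCD].
- by apply: fsubset_neq0 meet; rewrite fsetISS ?fsubsetUl.
Qed.

Section FiniteComponent.

Variable U : {fset G}.
Hypothesis eUK : U =i K.

Lemma left_stable_component H : {subset H <= K} -> left_stable H U.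
Proof. by move=> sHK x y /sHK xK; rewrite !eUK; apply: (group_closedM gK). Qed.

Lemma fragment_compl A B : fragment A B -> fragment (U `\` A) (U `\` B).
Proof.
move=> [stA stB sAB /fset0Pn[x xAB] [k kK kAB]]; split.
- by apply: left_stableD => //; exact: left_stable_component.
- by apply: left_stableD => //; exact: left_stable_component.
- by move=> y; rewrite !inE eUK => /orP[] /andP[].
- by apply/fset0Pn; exists k; rewrite !inE eUK kK !andbT -negb_or -in_fsetU.
- exists x; first by apply: sAB; rewrite !inE in xAB *; case/andP: xAB => ->.
  by rewrite !inE in xAB *; case/andP: xAB => -> ->.
Qed.

Lemma atom_card_le A B : atom A B -> (#|` A| + #|` B| <= #|` U|)%N.
Proof.
move=> [frAB _ min_card]; have [_ _ sAB _ _] := frAB.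
have sAU : A `<=` U by apply/fsubsetP=> x xA; rewrite eUK sAB // inE xA.
have sBU : B `<=` U by apply/fsubsetP=> x xB; rewrite eUK sAB // inE xB orbT.
have := min_card _ _ (fragment_compl frAB) (card_symdiff_compl sAU sBU).
rewrite !cardfsDS //.
by have := fsubset_leq_card sAU; have := fsubset_leq_card sBU; lia.
Qed.

End FiniteComponent.

Lemma card_symdiff_atomU A B C D : atom A B -> atom C D ->
    card_symdiff A B < #|` M| + #|` N| -> (A `&` B) `&` (C `&` D) != fset0 ->
  card_symdiff A B <= card_symdiff (A `|` C) (B `|` D).
Proof.
move=> atAB atCD small /fset0Pn[x]; rewrite fsetIACA => /fsetIP[xAC xBD].
have [frAB min_symdiff _] := atAB; have [frCD _ _] := atCD.
have [out|full] := EM (exists2 k, k \in K & k \notin A `|` C `|` (B `|` D)).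
  by apply: min_symdiff; exact: fragmentU.
have eUK : A `|` C `|` (B `|` D) =i K.
  move=> y; apply/idP/idP => [|yK]; last first.
    by apply/negPn/negP=> yU; apply: full; exists y.
  have [_ _ sAB _ _] := frAB; have [_ _ sCD _ _] := frCD.
  by rewrite fsetUACA => /fsetUP[]; [exact: sAB | exact: sCD].
have [stA stB _ _ _] := frAB; have [stC stD _ _ _] := frCD.
have := left_stable_cardU_le stA stC xAC.
have := left_stable_cardU_le stB stD xBD.
have := atom_card_le eUK atAB; have := atom_card_le eUK atCD.
have := card_symdiffU (A `|` C) (B `|` D); lia.
Qed.

Lemma meeting_atoms_eq A B C D : atom A B -> atom C D ->
    card_symdiff A B < #|` M| + #|` N| -> (A `&` B) `&` (C `&` D) != fset0 ->
  A = C /\ B = D.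
Proof.
move=> atAB atCD small meet.
have leU := card_symdiff_atomU atAB atCD small meet.
have [frAB minAB cardAB] := atAB; have [frCD minCD cardCD] := atCD.
have frI := fragmentI frAB frCD meet.
have eAB : card_symdiff (A `&` C) (B `&` D) = card_symdiff A B.
  have := card_symdiff_submodular A B C D.
  by have := minAB _ _ frI; have := minCD _ _ frAB; have := minAB _ _ frCD; lia.
have eCD : card_symdiff (A `&` C) (B `&` D) = card_symdiff C D.
  by have := minCD _ _ frAB; have := minAB _ _ frCD; lia.
have leAB := cardAB _ _ frI eAB; have leCD := cardCD _ _ frI eCD.
have leA := fsubset_leq_card (fsubsetIl A C).
have leB := fsubset_leq_card (fsubsetIl B D).
have leC := fsubset_leq_card (fsubsetIr A C).
have leD := fsubset_leq_card (fsubsetIr B D).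
have /eqP eA : A `&` C == A by rewrite eqEfcard fsubsetIl; lia.
have /eqP eC : A `&` C == C by rewrite eqEfcard fsubsetIr; lia.
have /eqP eB : B `&` D == B by rewrite eqEfcard fsubsetIl; lia.
have /eqP eD : B `&` D == D by rewrite eqEfcard fsubsetIr; lia.
by rewrite -{1}eA -{1}eB eC eD.
Qed.

Lemma atom_subgroup A B : atom A B -> card_symdiff A B < #|` M| + #|` N| ->
  1 \in A `&` B -> is_subgroup (A `&` B).
Proof.
move=> atAB small AB1; split=> // x y xAB yAB; have [frAB _ _] := atAB.
have atAByV := atom_rcoset (fragment_meetV frAB yAB) atAB.
have [|eA eB] := meeting_atoms_eq atAB atAByV small.
  by apply/fset0Pn; exists 1; rewrite !in_fsetI !mem1_rcosetV -!in_fsetI AB1.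
by rewrite eA eB in_fsetI !mem_rcoset invgK mulgVK -in_fsetI; exact: xAB.
Qed.

Lemma card_symdiff_fragment_ge A B : ~~ (M `<=` N) -> ~~ (N `<=` M) ->
    (forall F, is_subgroup F -> M `<=` F -> N `<=` F -> {subset K <= F}) ->
    fragment A B ->
  (#|` M| + #|` N| <= card_symdiff A B + #|` M `&` N|.*2)%N.
Proof.
move=> nMN nNM minK frAB; have [C [D [atCD CD1]]] := ex_atom_mem1 frAB.
have [[stC stD _ _ [k kK kCD]] /(_ _ _ frAB) leCD _] := atCD.
have [small|] := ltnP (card_symdiff C D) (#|` M| + #|` N|); last by lia.
have gF := atom_subgroup atCD small CD1.
have leMC : #|` M ** (C `&` D)| <= #|` C|.
  by apply/fsubset_leq_card/setprod_sub_stable => //; exact: fsubsetIl.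
have leND : #|` N ** (C `&` D)| <= #|` D|.
  by apply/fsubset_leq_card/setprod_sub_stable => //; exact: fsubsetIr.
have sMNF : M `&` N `<=` C `&` D.
  have [C1 D1] := fsetIP _ _ _ CD1; apply: fsetISS; apply/fsubsetP=> x xM.
    by rewrite -[x]mulg1; exact: stC.
  by rewrite -[x]mulg1; exact: stD.
have nMNF : ~~ ((M `<=` C `&` D) && (N `<=` C `&` D)).
  apply: contra kCD => /andP[sMF sNF].
  by have := minK _ gF sMF sNF k kK; rewrite !inE => /andP[->].
have := card_setprod_subgroup_ge gM gN gF sMNF nMN nNM nMNF.
have := card_symdiffE C D; lia.
Qed.

Definition slice A g : {fset G} := [fset x in A ** [fset g^-1] | x \in K].

Lemma mem_slice A g x : (x \in slice A g) = (x * g \in A) && (x \in K).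
Proof. by rewrite !(inE, mem_rcoset) invgK. Qed.

Lemma left_stable_slice H A g : {subset H <= K} -> left_stable H A ->
  left_stable H (slice A g).
Proof.
move=> sHK stA x y xH; rewrite !mem_slice -mulgA => /andP[ygA yK].
by rewrite stA //; exact: (group_closedM gK (sHK _ xH) yK).
Qed.

Lemma card_symdiff_slice A B g :
  card_symdiff (slice A g) (slice B g) <= card_symdiff A B.
Proof.
by rewrite -(card_symdiff_rcoset A B g^-1); exact: card_symdiff_filter.
Qed.

Lemma fragment_slice S s k : s \in S -> k \in K ->
    k * s \notin M ** S `|` N ** S ->
  fragment (slice (M ** S) s) (slice (N ** S) s).
Proof.
move=> sS kK ks; split.
- by apply: left_stable_slice => //; exact: left_stable_setprod.
- by apply: left_stable_slice => //; exact: left_stable_setprod.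
- by move=> x; rewrite in_fsetU !mem_slice => /orP[] /andP[].
- apply/fset0Pn; exists 1; rewrite in_fsetI !mem_slice !mul1g.
  by rewrite !(fsubsetP (sub_setprod _ _)) //; case: gK => ->.
- by exists k; rewrite // in_fsetU !mem_slice kK !andbT -in_fsetU.
Qed.

End Fragments.

Section SymdiffBound.

Variables (G : groupType) (M N : {fset G}).
Hypotheses (gM : is_subgroup M) (gN : is_subgroup N).
Implicit Types (F S : {fset G}).

(* If no finite subgroup contains both [M] and [N], this is all of [G] and not
   the subgroup that they generate. *)
Definition finite_join : {pred G} :=
  [pred x | `[< forall F, is_subgroup F -> M `<=` F -> N `<=` F -> x \in F >]].

Lemma finite_joinP x :
  reflect (forall F, is_subgroup F -> M `<=` F -> N `<=` F -> x \in F)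
          (x \in finite_join).
Proof. exact: asboolP. Qed.

Lemma finite_join_closed : group_closed finite_join.
Proof.
split=> [|x y /finite_joinP xF /finite_joinP yF].
  by apply/finite_joinP=> F [].
by apply/finite_joinP=> F gF sMF sNF; apply: gF.2; [exact: xF | exact: yF].
Qed.

Lemma sub_finite_joinl : {subset M <= finite_join}.
Proof.
by move=> x xM; apply/finite_joinP=> F _ /fsubsetP sMF _; exact: sMF.
Qed.

Lemma sub_finite_joinr : {subset N <= finite_join}.
Proof.
by move=> x xN; apply/finite_joinP=> F _ _ /fsubsetP sNF; exact: sNF.
Qed.

Lemma finite_join_min F : is_subgroup F -> M `<=` F -> N `<=` F ->
  {subset finite_join <= F}.
Proof. by move=> gF sMF sNF x /finite_joinP; apply. Qed.

Lemma finite_join_stable S : ~~ (M `<=` N) -> ~~ (N `<=` M) ->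
    (card_symdiff (M ** S) (N ** S) + #|` M `&` N|.*2 < #|` M| + #|` N|)%N ->
  {in finite_join & M ** S `|` N ** S, forall k x, k * x \in M ** S `|` N ** S}.
Proof.
move=> nMN nNM small k x kK xU.
have sMK := sub_finite_joinl; have sNK := sub_finite_joinr.
have [a aK [s sS ->]] :
    exists2 a, a \in finite_join & exists2 s, s \in S & x = a * s.
  case/fsetUP: xU => /setprodP[a aMN es]; exists a => //.
    exact: sMK.
  exact: sNK.
have gK := finite_join_closed; have {}kK := group_closedM gK kK aK.
rewrite mulgA; apply/negPn/negP=> out.
have frag := fragment_slice gM gN gK sMK sNK sS kK out.
have := card_symdiff_fragment_ge gM gN gK sMK sNK nMN nNM finite_join_min frag.
have := card_symdiff_slice finite_join (M ** S) (N ** S) s; lia.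
Qed.

Lemma card_symdiff_setprod_ge S :
    ~~ (M ** S `<=` N ** S) -> ~~ (N ** S `<=` M ** S) ->
  (#|` M| + #|` N| <= card_symdiff (M ** S) (N ** S) + #|` M `&` N|.*2)%N.
Proof.
move=> nMSNS nNSMS; rewrite leqNgt; apply/negP=> small.
have nMN : ~~ (M `<=` N) by apply: contra nMSNS; exact: setprodSl.
have nNM : ~~ (N `<=` M) by apply: contra nNSMS; exact: setprodSl.
have stable := finite_join_stable nMN nNM small.
have /fsubsetPn[z zM zN] := nMSNS; have /fsubsetPn[y yN yM] := nNSMS.
have leN : #|` N| <= #|` M ** S `\` (N ** S)|.
  apply: (left_stable_card_leqD gN _ _ zN); first exact: left_stable_setprod.
  by move=> h /sub_finite_joinr hK; rewrite stable // inE zM.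
have leM : #|` M| <= #|` N ** S `\` (M ** S)|.
  apply: (left_stable_card_leqD gM _ _ yM); first exact: left_stable_setprod.
  by move=> h /sub_finite_joinl hK; rewrite fsetUC stable // inE yN orbT.
by move: small; rewrite /card_symdiff; lia.
Qed.

End SymdiffBound.

Section Cells.

Variables (G : groupType) (S : {fset G}).
Implicit Types (H M N X Y : {fset G}).

Definition boundary X : int := (#|` X ** S|%:Z - #|` X|%:Z)%R.

Lemma cellI X Y : cell S X -> cell S Y -> cell S (X `&` Y).
Proof.
move=> cX cY z; rewrite in_fsetI negb_and => /orP[/cX|/cY];
  apply: contra => sub.
  by apply: fsubset_trans sub (setprodSl _ _); exact: fsubsetIl.
by apply: fsubset_trans sub (setprodSl _ _); exact: fsubsetIr.
Qed.

Lemma cell_setprod_sub X Y : cell S Y -> X ** S `<=` Y ** S -> X `<=` Y.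
Proof.
move=> cY sub; apply/fsubsetP=> z zX; apply/negPn/negP=> /cY/negP[].
by apply: fsubset_trans sub; apply: setprodSl; rewrite fsub1set.
Qed.

Lemma ukernelI_sub u M N : ukernel S u M -> cell S N ->
  boundary (M `&` N) = u -> M `<=` N.
Proof.
move=> [[cM _] minM] cN eu; apply/fsetIidPl/eqP.
by rewrite eqEfcard fsubsetIl minM //; split=> //; exact: cellI.
Qed.

(* The order of [H] divides [|M S| - |M|], which is smaller than [|H S|]. *)
Lemma boundary_subgroup_le H M : is_subgroup H -> is_subgroup M -> H `<=` M ->
  (boundary M <= #|` S|%:Z - 1 -> boundary M <= boundary H)%R.
Proof.
move=> gH gM sHM; rewrite /boundary => leS.
have /dvdnP[a ea] : #|` H| %| #|` M|.
  by apply: dvdn_card_left_stable => //; exact: left_stable_subgroup.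
have /dvdnP[b eb] : #|` H| %| #|` M ** S|.
  apply: dvdn_card_left_stable => //.
  by apply: left_stableS sHM _; exact: left_stable_setprod.
have /dvdnP[c ec] : #|` H| %| #|` H ** S|.
  by apply: dvdn_card_left_stable => //; exact: left_stable_setprod.
have := fsubset_leq_card (sub_setprod S gH).
move: leS; rewrite ea eb ec; move: #|` H| #|` S| => h s leS leHS.
have : b < c + a by rewrite ltnNge; apply/negP=> le; nia.
nia.
Qed.

Lemma boundaryI_le M N : is_subgroup M -> is_subgroup N ->
    cell S M -> cell S N -> ~~ (M `<=` N) -> ~~ (N `<=` M) ->
  (boundary (M `&` N) *+ 2 <= boundary M + boundary N)%R.
Proof.
move=> gM gN cM cN nMN nNM.
have := card_symdiff_setprod_ge gM gN (contra (cell_setprod_sub cN) nMN)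
  (contra (cell_setprod_sub cM) nNM).
have : #|` (M `&` N) ** S| <= #|` M ** S `&` (N ** S)|.
  by rewrite fsubset_leq_card // fsubsetI !setprodSl ?fsubsetIl ?fsubsetIr.
by have := card_symdiffE (M ** S) (N ** S); rewrite /boundary; lia.
Qed.

End Cells.

Theorem theorem4 (G : groupType) (S : {fset G}) (hS : 1 \in S)
    (u v : int) (M N : {fset G})
    (hMker : ukernel S u M) (hMgrp : is_subgroup M)
    (hNgrp : is_subgroup N) (hNcell : ucell S v N)
    (hu : (u <= #|` S|%:Z - 1)%R) (hv : (v <= #|` S|%:Z - 1)%R) :
  (ukernel S v N \/ u = v -> M `<=` N \/ N `<=` M) /\
  (ukernel S v N -> (v <= u)%R -> M `<=` N).
Proof.
have [[cM eu] _] := hMker; have [cN ev] := hNcell.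
rewrite -/(boundary S M) in eu; rewrite -/(boundary S N) in ev.
have gI := subgroupI hMgrp hNgrp.
have leu : (boundary S M <= boundary S (M `&` N))%R.
  by apply: boundary_subgroup_le; rewrite ?fsubsetIl ?eu.
have lev : (boundary S N <= boundary S (M `&` N))%R.
  by apply: boundary_subgroup_le; rewrite ?fsubsetIr ?ev.
have kernel_sub := ukernelI_sub hMker cN.
have comparable : M `<=` N \/ N `<=` M.
  apply/orP; apply/negPn; rewrite negb_or; apply/negP=> /andP[nMN nNM].
  case/negP: (nMN); apply: kernel_sub.
  by have := boundaryI_le hMgrp hNgrp cM cN nMN nNM; lia.
split=> // _ levu; case: comparable => // /fsetIidPr eI.
by apply: kernel_sub; rewrite eI in leu *; lia.
Qed.
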